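(* Let $X$ be a compact metric space and consider the semigroup action $\mathbb S$ generated by a collection of bi-Lipschitz homeomorphisms $G_1=\{id,f_1,\dots,f_\kappa\}$ of $X$. Assume that $\psi:X\to\mathbb R$ is a continuous observable and that: (a) the semigroup action $\mathbb S$ has frequent hitting times; (b) there exists $1\leqslant i\leqslant\kappa$ such that $\psi$ is not a coboundary with respect to $f_i$. Then the set $$\mathscr R_\Sigma=\{\underline\omega\in\Sigma_\kappa:\ I_{\mathcal F_{\underline\omega}}(\psi)\text{ is a Baire residual subset of }X\}$$ is a Baire residual subset of $\Sigma_\kappa$. In particular, $I_{\mathbb S}(\psi)$ is a Baire residual subset of $X$.
   Context: $\Sigma_\kappa=\{1,\dots,\kappa\}^{\mathbb N}$ (indices starting at $0$) with the product topology. For $\underline\omega\in\Sigma_\kappa$ and $n\geqslant1$, $f^n_{\underline\omega}=f_{\omega_{n-1}}\circ\cdots\circ f_{\omega_1}\circ f_{\omega_0}$, $f^0_{\underline\omega}=id$. Frequent hitting times: for every $\varepsilon>0$ there is $K(\varepsilon)\geqslant1$ such that for any ball $B_1\subset X$ of radius $\varepsilon$ and any ball $B_2\subset X$ of radius $|B_2|$ with $0<|B_2|\leqslant\varepsilon/2$ there exist $0\leqslant p\leqslant K(\varepsilon)$ and $\underline\omega\in\Sigma_\kappa$ such that $f^p_{\underline\omega}(B_1)$ contains a ball $B_2'\subset B_2$ of radius $|B_2|/2$. A continuous observable $\psi$ is not a coboundary with respect to a continuous map $f$ if $\inf_\mu\int\psi\,d\mu<\sup_\mu\int\psi\,d\mu$,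 with $\mu$ ranging over the $f$-invariant Borel probability measures. $I_{\mathcal F_{\underline\omega}}(\psi)=\{x\in X:\lim_{n\to\infty}\frac1n\sum_{j=0}^{n-1}\psi(f^j_{\underline\omega}(x))\text{ does not exist}\}$ and $I_{\mathbb S}(\psi)=\bigcup_{\underline\omega\in\Sigma_\kappa}I_{\mathcal F_{\underline\omega}}(\psi)$. Baire residual: containing a countable intersection of open dense sets. *)

(* Defs.v *)
From HB Require Import structures.
From mathcomp Require Import all_boot all_order all_algebra.
From mathcomp Require Import all_classical all_reals all_analysis.
From mathcomp Require Import borel_hierarchy.
Import Order.TTheory GRing.Theory Num.Theory.
Import numFieldNormedType.Exports.
Set Implicit Arguments.
Unset Strict Implicit.
Unset Printing Implicit Defensive.
Local Open Scope classical_set_scope.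
Local Open Scope ring_scope.

(* The library's measurable types are pointed, so the Borel structure of a
   metric space is only available once a base point is fixed. *)
#[short(type="pmetricType")]
HB.structure Definition PointedMetric (R : numDomainType) :=
  { M of Metric R M & isPointed M }.

Definition residual (T : topologicalType) (A : set T) : Prop :=
  exists2 G : set T, Gdelta_dense G & G `<=` A.

Definition homeomorphism (T : topologicalType) (f : T -> T) : Prop :=
  continuous f /\
  exists g : T -> T, [/\ cancel f g, cancel g f & continuous g].

Definition bi_lipschitz (R : realType) (X : metricType R) (f : X -> X) : Prop :=
  exists2 C : R, 0 < C &
    forall x y, C^-1 * mdist x y <= mdist (f x) (f y) <= C * mdist x y.

(* One-sided sequences over kappa symbols, numbered 0, ..., kappa - 1. *)
Definition Sigma (kappa : nat) : topologicalType :=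
  {ptws nat -> discrete_topology 'I_kappa}.

Fixpoint iterate (kappa : nat) (X : Type) (f : 'I_kappa -> X -> X)
    (w : Sigma kappa) (n : nat) : X -> X :=
  if n is m.+1 then f (w m) \o iterate f w m else id.

(* Balls are open, and are given by a centre and a radius, since the radius of
   a ball is not determined by its set of points. *)
Definition frequent_hitting_times (R : realType) (X : metricType R)
    (kappa : nat) (f : 'I_kappa -> X -> X) : Prop :=
  forall eps : R, 0 < eps ->
  exists2 K : nat, (1 <= K)%N &
    forall (x1 x2 : X) (r : R), 0 < r -> r <= eps / 2 ->
    exists (p : nat) (w : Sigma kappa) (z : X),
      [/\ (p <= K)%N,
          ball z (r / 2) `<=` ball x2 r &
          ball z (r / 2) `<=` iterate f w p @` ball x1 eps].

Notation borel X := (g_sigma_algebraType (@open X)).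

Definition invariant_measure (R : realType) (X : pmetricType R)
    (f : X -> X) (mu : probability (borel X) R) : Prop :=
  forall A : set (borel X), measurable A -> mu (f @^-1` A) = mu A.

Definition invariant_integrals (R : realType) (X : pmetricType R)
    (f : X -> X) (psi : X -> R) : set (\bar R) :=
  [set (\int[mu]_(x in [set: borel X]) (psi x)%:E)%E
    | mu in [set mu | invariant_measure f mu]].

Definition not_coboundary (R : realType) (X : pmetricType R)
    (f : X -> X) (psi : X -> R) : Prop :=
  (ereal_inf (invariant_integrals f psi)
     < ereal_sup (invariant_integrals f psi))%E.

Definition birkhoff_average (R : realType) (X : Type) (kappa : nat)
    (f : 'I_kappa -> X -> X) (psi : X -> R) (w : Sigma kappa) (x : X)
    (n : nat) : R :=
  n%:R^-1 * \sum_(j < n) psi (iterate f w j x).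

Definition irregular_set (R : realType) (X : Type) (kappa : nat)
    (f : 'I_kappa -> X -> X) (psi : X -> R) (w : Sigma kappa) : set X :=
  [set x | ~ cvgn (birkhoff_average f psi w x)].

Definition semigroup_irregular_set (R : realType) (X : Type) (kappa : nat)
    (f : 'I_kappa -> X -> X) (psi : X -> R) : set X :=
  \bigcup_(w in [set: Sigma kappa]) irregular_set f psi w.

(* Main.v *)
Require Import Defs.
From mathcomp Require Import all_boot all_order all_algebra.
From mathcomp Require Import all_classical all_reals all_analysis.
From mathcomp Require Import measurable_realfun.
From mathcomp Require Import lra.
Import Order.TTheory GRing.Theory Num.Theory.
Import numFieldNormedType.Exports.
Set Implicit Arguments.
Unset Strict Implicit.
Unset Printing Implicit Defensive.
Local Open Scope classical_set_scope.
Local Open Scope ring_scope.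

(** Since [psi] is not a coboundary for [f i], there are invariant measures
    whose integrals [a < b] of [psi] differ.  Integrating the Birkhoff sum of
    length [n] against the first one shows that, for every [n], some point has
    an [n]-step average below any given number above [a]
    ([integral_lt_exists_sum_lt]); no ergodic theorem is involved, because the
    point may depend on [n].  Applied to [- psi], the same argument yields
    points with averages close to [b] or larger.

    Let [c] exceed [a], and call a dip of [w] a point whose average along [w]
    is below [c] at some time after [N].  Given a word [w], a prefix length [m]
    and a nonempty open set [U], the image of [U] under the prefix contains a
    ball of some radius [eps].  Choose [n] huge compared with [m] and with the
    hitting time [K] of [eps], and then a point whose [n]-step average under
    [f i] is low; by continuity, the average stays low on a small ball around
    it.  Frequent hitting leads a point of [U] into that small ball in at most
    [K] further steps, and appending the constant word [i] makes the average at
    time about [m + K + n] low, because the contribution of the first [m + K]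
    steps is negligible.  As [K] depends on [eps] alone, the choice of [n]
    before the small ball is not circular.  Hence the words for which [U] meets
    the dips are dense ([dense_words_dips]); they form an open set, because a
    dip only involves finitely many letters.

    Letting [U] run through a countable family of open sets that refines every
    open set, and [N] through the naturals, a residual set of words [w] has
    dense, open sets of dips for all [N] ([residual_words_dips]).  Intersecting
    with the analogous statement for [- psi], residually many points have
    averages that are infinitely often below and infinitely often above two
    separated levels, so that they do not converge.  The second assertion
    follows from the Baire property of the space of words: at least one word
    [w] is in the residual set. *)

(** * Residual sets *)

Lemma residualS (T : topologicalType) (A B : set T) :
  A `<=` B -> residual A -> residual B.
Proof. by move=> AB [G dG GA]; exists G => // x /GA/AB. Qed.

Lemma open_dense_residual (T : topologicalType) (A : set T) :
  open A -> dense A -> residual A.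
Proof.
move=> oA dA; exists A => //; exists (fun=> A) => //.
by rewrite bigcap_const.
Qed.

(** Two countable indices, one for the sets and one for the dense open sets
    below each of them, are merged into one; numbers that code no pair of
    indices contribute the whole space. *)
Lemma residual_bigcap (T : topologicalType) (I : countType) (F : I -> set T) :
  (forall i, residual (F i)) -> residual (\bigcap_i F i).
Proof.
move=> resF.
have /choice[G GP] i : exists G : nat -> set T,
    (forall n, open (G n) /\ dense (G n)) /\ \bigcap_n G n `<=` F i.
  by have [_ [G oG ->] GF] := resF i; exists G.
pose H n := if unpickle n is Some p then G p.1 p.2 else [set: T].
exists (\bigcap_n H n).
  exists H => // n; rewrite /H; case: unpickle => [p|]; first exact: (GP p.1).1.
  by split; [exact: openT | move=> U U0 _; rewrite setIT].
move=> x Hx i _; apply: (GP i).2 => n _.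
by have := Hx (pickle (i, n)) Logic.I; rewrite /H pickleK.
Qed.

Lemma residualI (T : topologicalType) (A B : set T) :
  residual A -> residual B -> residual (A `&` B).
Proof.
move=> resA resB.
apply: (@residualS _ (\bigcap_b (if b then A else B))); last first.
  by apply: residual_bigcap => -[].
by move=> x ABx; split; [exact: (ABx true) | exact: (ABx false)].
Qed.

(** The nonempty members of a countable basis, enumerated.  The whole space
    fills the gaps of the enumeration, so that every [e n] is nonempty. *)
Lemma second_countable_pibase (T : ptopologicalType) :
  @second_countable T ->
  exists e : nat -> set T, (forall n, open (e n) /\ e n !=set0) /\
    forall U, open U -> U !=set0 -> exists n, e n `<=` U.
Proof.
move=> [B /countable_injP[g ginj] [oB bB]].
have /choice[e eP] n : exists V : set T, (open V /\ V !=set0) /\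
    forall W, B W -> W !=set0 -> g W = n -> V = W.
  have [[W [BW W0 gW]]|noW] :=
    pselect (exists W, [/\ B W, W !=set0 & g W = n]).
    exists W; split; first by split => //; exact: oB.
    move=> W' BW' _ gW'; apply: ginj; rewrite ?inE//.
    by rewrite gW.
  exists setT; split; first by split; [exact: openT | exists point].
  by move=> W BW W0 gW; case: noW; exists W.
exists e; split; first by move=> n; exact: (eP n).1.
move=> U oU [x Ux]; have := bB x U; case; first exact: open_nbhs_nbhs.
move=> W [BW Wx] WU; exists (g W).
by rewrite ((eP (g W)).2 W)//; exists x.
Qed.

(** * The space of words *)

Section words.
Variable kappa : nat.
Implicit Types (v w : Sigma kappa) (A : set (Sigma kappa)).

Definition cylinder w n : set (Sigma kappa) :=
  [set v | forall j, (j < n)%N -> v j = w j].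

Lemma nbhs_cylinder w n : nbhs w (cylinder w n).
Proof.
elim: n => [|n IH]; first by apply: filterS filterT.
have wn : nbhs w [set v : Sigma kappa | v n = w n].
  have /(_ [set w n]) := @proj_continuous nat
    (fun=> discrete_topology 'I_kappa) n w.
  by apply; rewrite /= nbhs_principalE.
apply: filterS (filterI IH wn) => v [vw vn] j; rewrite ltnS leq_eqVlt.
by case/predU1P => [->//|]; exact: vw.
Qed.

(** The cylinders around [w] generate a filter that converges to [w]
    coordinatewise, hence in the product topology. *)
Lemma cylinder_nbhs w A : nbhs w A -> exists n, cylinder w n `<=` A.
Proof.
move=> wA; pose F := filter_from [set: nat] (cylinder w).
have FF : Filter F.
  apply: filter_from_filter; first by exists 0%N.
  move=> i j _ _; exists (maxn i j) => // v vw.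
  by split => k ki; apply: vw; rewrite leq_max ki ?orbT.
have : F --> w.
  apply/(@pointwise_cvgP nat (discrete_topology 'I_kappa) F) => t.
  apply/discrete_cvg.
  by exists t.+1 => // v; apply.
by move=> /(_ A wA)[n _ nA]; exists n.
Qed.

(** Baire's theorem for words: cylinders with longer and longer prefixes are
    nested, the [k]-th one inside the first [k] dense open sets, and their
    prefixes determine a word in all of them.  The word [w] only witnesses
    that the alphabet is nonempty. *)
Lemma residual_words_nonempty w A : residual A -> A !=set0.
Proof.
move=> [_ [W oW ->] WA].
have /choice[g gP] (p : nat * (Sigma kappa * nat)) :
    exists q : Sigma kappa * nat, (p.2.2 < q.2)%N /\
      cylinder q.1 q.2 `<=` cylinder p.2.1 p.2.2 `&` W p.1.
  case: p => k [u m] /=; have [Wk dWk] := oW k.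
  have [v [cv Wv]] : (cylinder u m)° `&` W k !=set0.
    apply: dWk; first by exists u; exact: nbhs_cylinder.
    exact: open_interior.
  have [n nW] := cylinder_nbhs (open_nbhs_nbhs (conj Wk Wv)).
  exists (v, maxn n m.+1) => /=; split; first by rewrite leq_max leqnn orbT.
  move=> x xv; split.
    move=> j jm; rewrite xv; last by rewrite leq_max (leqW jm) orbT.
    exact: (interior_subset cv).
  by apply: nW => j jn; rewrite xv// leq_max jn.
pose s := fix s k := if k is l.+1 then g (l, s l) else (w, 0%N).
have s_nest k d : cylinder (s (k + d)%N).1 (s (k + d)%N).2 `<=`
    cylinder (s k).1 (s k).2.
  elim: d => [|d IH]; first by rewrite addn0.
  by rewrite addnS => x /((gP (_, _)).2)[/IH].
have s_size k : (k <= (s k).2)%N.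
  by elim: k => [//|k IH]; exact: leq_ltn_trans IH (gP (k, s k)).1.
(* [k <= (s k).2], so the letter [j] is settled from stage [j.+1] on. *)
pose v : Sigma kappa := fun j => (s j.+1).1 j.
have vs k : cylinder (s k).1 (s k).2 v.
  move=> j jk; rewrite /v.
  have <- : (s (j.+1 + k)%N).1 j = (s j.+1).1 j.
    by apply: (s_nest j.+1 k) => //; exact: s_size.
  by rewrite addnC; apply: (s_nest k j.+1).
exists v; apply: WA => k _.
by have [] := (gP (k, s k)).2 v (vs k.+1).
Qed.

End words.

(** * Finite Birkhoff sums and invariant measures *)

Section invariant_measures.
Context {R : realType} {X : pmetricType R}.
Implicit Types (g : X -> X) (psi : X -> R).

Lemma continuous_borel_measurable g :
  continuous g -> measurable_fun [set: borel X] (g : borel X -> borel X).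
Proof.
move=> /continuousP cg.
apply: (@measurability _ _ (borel X) (borel X) _ _ (@open X)) => //.
by move=> _ [U oU <-]; rewrite setTI; apply: sub_sigma_algebra; exact: cg.
Qed.

Lemma continuous_measurable_real psi :
  continuous psi -> measurable_fun [set: borel X] (psi : borel X -> R).
Proof.
move=> /continuousP cpsi; apply: (measurability _ (RGenOpens.measurableE R)).
move=> _ [_ [a [b ->] <-]]; rewrite setTI; apply: sub_sigma_algebra.
by apply: cpsi; exact: interval_open.
Qed.

Lemma compact_continuous_bounded psi :
  compact [set: X] -> continuous psi -> exists M : R, forall x, `|psi x| <= M.
Proof.
move=> cX cpsi; have : compact (psi @` setT).
  by apply: continuous_compact cX; exact: continuous_subspaceT.
move=> /compact_bounded[M [_ MP]]; exists (M + 1) => x.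
by apply: MP; [rewrite ltrDl | exists x].
Qed.

Lemma continuous_integrable psi (mu : probability (borel X) R) :
  compact [set: X] -> continuous psi ->
  mu.-integrable [set: borel X] (EFin \o psi).
Proof.
move=> cX cpsi; apply: measurable_bounded_integrable => //.
- by rewrite (le_lt_trans (probability_le1 mu measurableT))// ltry.
- exact: continuous_measurable_real.
have [M psiM] := compact_continuous_bounded cX cpsi.
exists M; split; first exact: num_real.
by move=> N /ltW MN x _; exact: le_trans (psiM x) MN.
Qed.

Lemma continuous_integral_fin_num psi (mu : probability (borel X) R) :
  compact [set: X] -> continuous psi ->
  (\int[mu]_(x in [set: borel X]) (psi x)%:E \is a fin_num)%E.
Proof.
move=> cX cpsi.
exact: (integrable_fin_num measurableT (continuous_integrable mu cX cpsi)).
Qed.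

Lemma continuous_integralN psi (mu : probability (borel X) R) :
  compact [set: X] -> continuous psi ->
  (\int[mu]_(x in [set: borel X]) ((\- psi) x)%:E =
   - \int[mu]_(x in [set: borel X]) (psi x)%:E)%E.
Proof.
move=> cX cpsi; under eq_integral do rewrite EFinN.
rewrite integralN//.
exact: integrable_add_def (continuous_integrable mu cX cpsi).
Qed.

Lemma invariant_integral_comp g psi (mu : probability (borel X) R) :
  compact [set: X] -> continuous g -> continuous psi ->
  invariant_measure g mu ->
  (\int[mu]_(x in [set: borel X]) (psi (g x))%:E =
   \int[mu]_(x in [set: borel X]) (psi x)%:E)%E.
Proof.
move=> cX cg cpsi ginv.
have mg := continuous_borel_measurable cg.
have cpsig : continuous (psi \o g).
  by move=> x; apply: continuous_comp; [exact: cg | exact: cpsi].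
rewrite [RHS](eq_measure_integral (pushforward mu (g : borel X -> borel X))).
  rewrite (@integral_pushforward _ _ _ _ _ _ mg mu setT (EFin \o psi))//.
    by apply/measurable_EFinP; exact: continuous_measurable_real.
  exact: continuous_integrable cX cpsig.
by move=> A mA _; exact/esym/ginv.
Qed.

Lemma continuous_iter g n : continuous g -> continuous (iter n g).
Proof.
move=> cg; elim: n => [|n IH] x; first exact: cvg_id.
by apply: continuous_comp; [exact: IH | exact: cg].
Qed.

Lemma continuous_comp_iter g psi n :
  continuous g -> continuous psi -> continuous (psi \o iter n g).
Proof.
move=> cg cpsi x; apply: continuous_comp; last exact: cpsi.
exact: (@continuous_iter g n cg x).
Qed.

Lemma invariant_integral_iter g psi (mu : probability (borel X) R) n :
  compact [set: X] -> continuous g -> continuous psi ->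
  invariant_measure g mu ->
  (\int[mu]_(x in [set: borel X]) (psi (iter n g x))%:E =
   \int[mu]_(x in [set: borel X]) (psi x)%:E)%E.
Proof.
move=> cX cg cpsi ginv; elim: n => [//|n IH]; rewrite -IH.
under eq_integral do rewrite iterSr.
apply: (@invariant_integral_comp g (psi \o iter n g)) => //.
exact: continuous_comp_iter.
Qed.

(** By invariance, the Birkhoff sum of length [n] has integral [n] times that
    of [psi]; a function whose values are all at least [n * c] cannot have an
    integral below [n * c]. *)
Lemma integral_lt_exists_sum_lt g psi (mu : probability (borel X) R) c n :
  compact [set: X] -> continuous g -> continuous psi ->
  invariant_measure g mu -> (0 < n)%N ->
  (\int[mu]_(x in [set: borel X]) (psi x)%:E < c%:E)%E ->
  exists x, \sum_(j < n) psi (iter j g x) < n%:R * c.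
Proof.
move=> cX cg cpsi ginv n0 psic; apply: contrapT => /forallNP sum_ge.
have intg j : mu.-integrable [set: borel X]
    (fun x => (psi (iter j g x))%:E).
  apply: (@continuous_integrable (psi \o iter j g)) => //.
  exact: continuous_comp_iter.
have : ((n%:R * c)%:E <= \int[mu]_(x in [set: borel X])
    (\sum_(j < n) (psi (iter j g x))%:E))%E.
  rewrite -[leLHS]mule1 -(@probability_setT _ _ _ mu) -integral_cst//.
  apply: le_integral => //.
  - exact: finite_measure_integrable_cst.
  - by apply: integrable_sum => // j _; exact: intg.
  - by move=> x _; rewrite sumEFin lee_fin leNgt; apply/negP; exact: sum_ge.
rewrite integral_sum//.
rewrite (eq_bigr (fun=>
    \int[mu]_(x in [set: borel X]) (psi x)%:E)%E); last first.
  by move=> j _; exact: invariant_integral_iter.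
have fi := continuous_integral_fin_num mu cX cpsi.
move: psic; rewrite -(fineK fi) lte_fin sumEFin lee_fin => psic.
rewrite sumr_const card_ord -[leRHS]mulr_natl leNgt => /negP; apply.
by rewrite ltr_pM2l// ltr0n.
Qed.

End invariant_measures.

(** * Birkhoff sums along words *)

Section random_orbits.
Context {R : realType} {X : Type} {kappa : nat}.
Variables (f : 'I_kappa -> X -> X) (psi : X -> R).
Implicit Types (v w : Sigma kappa) (x : X).

Definition splice w m v : Sigma kappa :=
  fun j => if (j < m)%N then w j else v (j - m)%N.

Definition birkhoff_sum w x n : R := \sum_(j < n) psi (iterate f w j x).

Lemma iterate_cylinder w n v j :
  cylinder w n v -> (j <= n)%N -> iterate f v j = iterate f w j.
Proof.
move=> vw; elim: j => [//|j IH] jn /=.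
by rewrite vw// IH// ltnW.
Qed.

Lemma birkhoff_sum_cylinder w n v x :
  cylinder w n v -> birkhoff_sum v x n = birkhoff_sum w x n.
Proof.
move=> vw; apply: eq_bigr => j _.
by rewrite (iterate_cylinder vw)// ltnW.
Qed.

Lemma splice_cylinder w m v : cylinder w m (splice w m v).
Proof. by move=> j jm; rewrite /splice jm. Qed.

Lemma iterate_splice w m v k x :
  iterate f (splice w m v) (m + k) x = iterate f v k (iterate f w m x).
Proof.
elim: k => [|k IH].
  by rewrite addn0 (iterate_cylinder (@splice_cylinder w m v)).
by rewrite addnS /= IH /splice ltnNge leq_addr/= addKn.
Qed.

Lemma birkhoff_sum_splice w m v k x :
  birkhoff_sum (splice w m v) x (m + k) =
  birkhoff_sum w x m + birkhoff_sum v (iterate f w m x) k.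
Proof.
rewrite /birkhoff_sum big_split_ord /=; congr +%R.
  exact: birkhoff_sum_cylinder (@splice_cylinder w m v).
by apply: eq_bigr => j _; rewrite iterate_splice.
Qed.

Lemma iterate_const i n x : iterate f (fun=> i) n x = iter n (f i) x.
Proof. by elim: n => [//|n IH] /=; rewrite IH. Qed.

Lemma birkhoff_average_lt w x n c : (0 < n)%N ->
  (birkhoff_average f psi w x n < c) = (birkhoff_sum w x n < n%:R * c).
Proof. by move=> n0; rewrite /birkhoff_average ltr_pdivrMl// ltr0n. Qed.

Lemma birkhoff_sum_le w x n M :
  (forall y, psi y <= M) -> birkhoff_sum w x n <= n%:R * M.
Proof.
move=> psiM; rewrite mulr_natl -[n in leRHS]card_ord -sumr_const.
by apply: ler_sum.
Qed.

(** [N < n] makes [n] positive, so that the inequality says that the average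
    at time [n] is less than [c]. *)
Definition dips c w N : set X :=
  [set x | exists2 n, (N < n)%N & birkhoff_sum w x n < n%:R * c].

Lemma dips_cylinder c w N x : dips c w N x ->
  exists n, forall v, cylinder w n v -> dips c v N x.
Proof.
move=> [n Nn sn]; exists n => v vw; exists n => //.
by rewrite (birkhoff_sum_cylinder _ vw).
Qed.

Lemma open_words_dips c N (U : set X) :
  open [set w | (U `&` dips c w N) !=set0].
Proof.
rewrite openE => w [x [Ux dx]]; have [n nx] := dips_cylinder dx.
apply: filterS (nbhs_cylinder w n) => v /nx dv.
by exists x.
Qed.

End random_orbits.

Section continuous_orbits.
Context {R : realType} {X : topologicalType} {kappa : nat}.
Variables (f : 'I_kappa -> X -> X) (psi : X -> R).
Hypothesis homeo_f : forall i, homeomorphism (f i).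
Hypothesis cont_psi : continuous psi.
Implicit Types (w : Sigma kappa).

Lemma continuous_iterate w n : continuous (iterate f w n).
Proof.
elim: n => [|n IH] x; first exact: cvg_id.
by apply: continuous_comp; [exact: IH | exact: (homeo_f _).1].
Qed.

Lemma open_image_iterate w n (U : set X) :
  open U -> open (iterate f w n @` U).
Proof.
move=> oU; elim: n => [|n IH]; first by rewrite image_id.
rewrite (_ : iterate f w n.+1 = f (w n) \o iterate f w n)// -image_comp.
have [_ [g [fg gf cg]]] := homeo_f (w n).
rewrite (_ : f (w n) @` _ = g @^-1` (iterate f w n @` U)).
  by move/continuousP : cg; apply.
apply/seteqP; split => [_ [x Ux <-]|y Uy]; first by rewrite /= fg.
by exists (g y).
Qed.

Lemma continuous_birkhoff_sum w n :
  continuous (fun x => birkhoff_sum f psi w x n).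
Proof.
apply: continuous_big => [|j _ x]; first exact: add_continuous.
by apply: (@continuous_comp _ _ _ (iterate f w j) psi x);
  [exact: continuous_iterate | exact: cont_psi].
Qed.

Lemma open_birkhoff_sum_lt w n c :
  open [set x | birkhoff_sum f psi w x n < c].
Proof.
have /continuousP/(_ [set y | y < c]) := @continuous_birkhoff_sum w n.
by apply; exact: open_lt.
Qed.

Lemma open_dips c w N : open (dips f psi c w N).
Proof.
rewrite (_ : dips _ _ _ _ _ = \bigcup_(n in [set n | (N < n)%N])
    [set x | birkhoff_sum f psi w x n < n%:R * c])//.
by apply: bigcup_open => n _; exact: open_birkhoff_sum_lt.
Qed.

End continuous_orbits.

(** * Dips are generic *)

Section hitting.
Context {R : realType} {X : pmetricType R} {kappa : nat}.
Variables (f : 'I_kappa -> X -> X).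
Hypothesis compactX : compact [set: X].
Hypothesis homeo_f : forall i, homeomorphism (f i).
Hypothesis hitting : frequent_hitting_times f.
Implicit Types (psi : X -> R) (w : Sigma kappa).

(** The word that is sought follows [w] up to [m], then a word that hits a
    small ball around a point with a low average under [f i], and then is
    constantly [i]. *)
Lemma dense_words_dips psi i c c' N (U : set X) :
  continuous psi -> c < c' ->
  (forall n, (0 < n)%N ->
    exists x, birkhoff_sum f psi (fun=> i) x n < n%:R * c) ->
  open U -> U !=set0 -> dense [set w | (U `&` dips f psi c' w N) !=set0].
Proof.
move=> cont_psi cc' low oU [u Uu] O [w Ow] oO.
have [m mO] := cylinder_nbhs (open_nbhs_nbhs (conj oO Ow)).
have : nbhs (iterate f w m u) (iterate f w m @` U).
  apply: open_nbhs_nbhs; split; first exact: open_image_iterate.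
  by exists u.
move=> /nbhs_ballP[eps /= eps0 epsU].
have [K _ Khit] := hitting eps0.
have [M psiM] := compact_continuous_bounded compactX cont_psi.
have {}psiM y : psi y <= M by exact: le_trans (ler_norm _) (psiM y).
(* Before the constant part begins, at most [m + K] steps are spent, and
   each of them exceeds the target [c'] by at most [`|M| + `|c'|]. *)
pose B := (m + K)%:R * (`|M| + `|c'|).
have [n nB] : exists n, B < n%:R * (c' - c).
  exists (Num.truncn (B / (c' - c))).+1.
  by rewrite -ltr_pdivrMr ?subr_gt0// truncnS_gt.
have [x2 x2low] := low (maxn n N).+1 isT.
set l := (maxn n N).+1 in x2low.
have : nbhs x2 [set x | birkhoff_sum f psi (fun=> i) x l < l%:R * c].
  by apply: open_nbhs_nbhs; split => //; exact: open_birkhoff_sum_lt.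
move=> /nbhs_ballP[r /= r0 rlow].
pose r' := Num.min r (eps / 2).
have r'0 : 0 < r' by rewrite lt_min r0 divr_gt0.
have [|p [v [z [pK zx2 zU]]]] := Khit (iterate f w m u) x2 r' r'0.
  by rewrite ge_min lexx orbT.
have zz : ball z (r' / 2) z by apply: ballxx; rewrite divr_gt0.
have [y /epsU[x Ux <-] yz] := zU z zz.
have zlow : birkhoff_sum f psi (fun=> i) z l < l%:R * c.
  by apply: rlow; apply: le_ball (zx2 z zz); rewrite ge_min lexx.
exists (splice w m (splice v p (fun=> i))); split.
  by apply: mO; exact: splice_cylinder.
exists x; split=> //; exists (m + (p + l))%N.
  do 2 apply: leq_trans (leq_addl _ _).
  by rewrite ltnS leq_maxr.
rewrite !birkhoff_sum_splice yz !natrD.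
have prefix_le : (m%:R + p%:R) * (M - c') <= B.
  rewrite -natrD (@le_trans _ _ ((m + p)%:R * (`|M| + `|c'|)))//.
    by rewrite ler_wpM2l// lerD ?ler_norm// -normrN ler_norm.
  by rewrite ler_wpM2r ?addr_ge0// ler_nat leq_add2l.
have tail_le : n%:R * (c' - c) <= l%:R * (c' - c).
  by rewrite ler_wpM2r ?subr_ge0 ?(ltW cc')// ler_nat leqW// leq_maxl.
have sum_w := birkhoff_sum_le f w x m psiM.
have sum_v := birkhoff_sum_le f v (iterate f w m x) p psiM.
lra.
Qed.

Lemma residual_words_dips psi i c c' :
  continuous psi -> c < c' ->
  (forall n, (0 < n)%N ->
    exists x, birkhoff_sum f psi (fun=> i) x n < n%:R * c) ->
  residual [set w | residual (\bigcap_N dips f psi c' w N)].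
Proof.
move=> cont_psi cc' low.
have [e [eP ebase]] := second_countable_pibase
  (compact_second_countable compactX).
apply: (@residualS _ (\bigcap_(q : nat * nat)
    [set w | (e q.1 `&` dips f psi c' w q.2) !=set0])).
  move=> w ew; apply: residual_bigcap => N.
  apply: open_dense_residual; first exact: open_dips.
  move=> U U0 oU; have [n nU] := ebase U oU U0.
  have [x [ex dx]] := ew (n, N) Logic.I.
  by exists x; split => //; exact: nU.
apply: residual_bigcap => -[n N]; apply: open_dense_residual.
  exact: open_words_dips.
by have [oe e0] := eP n; exact: dense_words_dips low oe e0.
Qed.

End hitting.

(** Dips of [- psi] below [- b] are excursions of the averages of [psi] above
    [b]. *)
Lemma irregular_set_dips (R : realType) (X : Type) (kappa : nat)
    (f : 'I_kappa -> X -> X) (psi : X -> R) (a b : R) (w : Sigma kappa) :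
  a < b ->
  (\bigcap_N dips f psi a w N) `&` (\bigcap_N dips f (\- psi) (- b) w N) `<=`
  irregular_set f psi w.
Proof.
move=> ab x [lowx highx] /= /cvg_ex[/= l].
move=> /cvgrPdist_lt/(_ ((b - a) / 2)).
rewrite divr_gt0 ?subr_gt0// => /(_ isT)[N _ lN].
have [n Nn] := lowx N Logic.I.
have n0 : (0 < n)%N by exact: leq_ltn_trans Nn.
rewrite -birkhoff_average_lt// => an.
have [k Nk] := highx N Logic.I.
have k0 : (0 < k)%N by exact: leq_ltn_trans Nk.
rewrite -birkhoff_average_lt// /birkhoff_average sumrN mulrN ltrN2 => bk.
have /= := lN n (ltnW Nn); have /= := lN k (ltnW Nk).
rewrite /birkhoff_average in an *.
rewrite !ltr_norml => /andP[k1 k2] /andP[n1 n2].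
lra.
Qed.

Theorem theorem3 (R : realType) (X : pmetricType R) (kappa : nat)
    (f : 'I_kappa -> X -> X) (psi : X -> R)
    (compactX : compact [set: X])
    (homeo_f : forall i, homeomorphism (f i))
    (bilip_f : forall i, bi_lipschitz (f i))
    (cont_psi : continuous psi)
    (hitting : frequent_hitting_times f)
    (noncob : exists i, not_coboundary (f i) psi) :
  residual [set w : Sigma kappa | residual (irregular_set f psi w)] /\
  residual (semigroup_irregular_set f psi).
Proof.
suff main : residual [set w : Sigma kappa | residual (irregular_set f psi w)].
  split=> //; have [i _] := noncob.
  have [w resw] := residual_words_nonempty (fun=> i) main.
  by apply: residualS resw => x irrx; exists w.
have [i] := noncob.
move=> /ereal_sup_gt[_ [mu2 inv2 <-]] /ereal_inf_lt[_ [mu1 inv1 <-]].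
have cf := (homeo_f i).1.
(* Stated for any observable, as it is used for [psi] and for [- psi]. *)
have low phi mu c : continuous phi -> invariant_measure (f i) mu ->
    (\int[mu]_(x in [set: borel X]) (phi x)%:E < c%:E)%E ->
    forall n, (0 < n)%N ->
      exists x, birkhoff_sum f phi (fun=> i) x n < n%:R * c.
  move=> cphi inv lt n n0.
  have [x xlow] := integral_lt_exists_sum_lt compactX cf cphi inv n0 lt.
  exists x; rewrite /birkhoff_sum.
  by under eq_bigr do rewrite iterate_const.
have cont_npsi : continuous (\- psi) by move=> x; exact: (cvgN (cont_psi x)).
have fin mu := continuous_integral_fin_num mu compactX cont_psi.
have := low (\- psi) mu2 _ cont_npsi inv2.
rewrite (continuous_integralN mu2 compactX cont_psi).
have := low psi mu1 _ cont_psi inv1.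
rewrite -(fineK (fin mu1)) -(fineK (fin mu2)) lte_fin.
set a := fine _; set b := fine _ => lowa lowb ab.
(* The averages are shown to visit both sides of the gap between
   [a + 2 * d] and [b - 2 * d], which has length [d]; the other steps of length
   [d] are the losses in passing from integrals to points and from points to
   open sets. *)
pose d := (b - a) / 5; have d0 : 0 < d by rewrite divr_gt0 ?subr_gt0.
have {lowa}lowa := lowa (a + d); rewrite lte_fin ltrDl in lowa.
have {lowb}lowb := lowb (- (b - d)); rewrite -EFinN lte_fin ltrN2 in lowb.
have res1 := @residual_words_dips R X kappa f compactX homeo_f hitting
  psi i (a + d) (a + 2 * d) cont_psi _ (lowa d0).
have res2 := @residual_words_dips R X kappa f compactX homeo_f hitting
  (\- psi) i (- (b - d)) (- (b - 2 * d)) cont_npsi _ (lowb _).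
apply: residualS (residualI (res1 _) (res2 _ _)).
- move=> w [/= low1 low2]; apply: residualS (residualI low1 low2).
  by apply: irregular_set_dips; rewrite /d; lra.
- lra.
- lra.
- lra.
Qed.
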